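(* Let $p\in[1,\infty]$. Given a metric pair $(X,d,A)$, $(D(X,A),W_p[d,A],+,0)$ is the universal $p$-subadditive commutative metric monoid obtained from $(X,d,A)$. That is, given any $p$-subadditive commutative metric monoid $(N,\rho,+,0)$ and any $1$-Lipschitz map $\varphi:(X,d,A)\to(N,\rho,0)$ (so $\varphi(A)\subset\{0\}$), there is a unique $1$-Lipschitz monoid homomorphism $\tilde\varphi:(D(X,A),W_p[d,A],+,0)\to(N,\rho,+,0)$ such that $\tilde\varphi\circ i=\varphi$, where $i:X\to D(X,A)$ is the canonical inclusion.
   Context: A metric space is a pair $(X,d)$ with $X$ a set and $d:X\times X\to[0,\infty]$ satisfying $d(x,x)=0$, $d(x,y)=d(y,x)$ and $d(x,y)\le d(x,z)+d(z,y)$ (an extended pseudometric). A metric map ($1$-Lipschitz map) is a function $f$ with $d_Y(f(x),f(y))\le d_X(x,y)$. A metric pair $(X,d,A)$ is a metric space $(X,d)$ with a nonempty subset $A\subset X$; morphisms (maps) $f:(X,d,A)\to(Y,d',B)$ are metric maps with $f(A)\subset B$. A pointed metric space $(X,d,x_0)$ is a metric pair with $A=\{x_0\}$. The $p$-norms $\|\cdot\|_p$ are the usual ones on finite tuples ($\max$ of absolute values for $p=\infty$), extended to entries in $[0,\infty]$. A $p$-subadditive commutative metric monoid is a tuple $(M,d,+,0)$ with $(M,d,0)$ a pointed metric space and $(M,+,0)$ a commutative monoid such that $d(a+b,a'+b')\le\|(d(a,a'),d(b,b'))\|_p$ for all $a,b,a',b'\in M$. $D(X)$ is the free commutative monoid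 on $X$ (finite formal sums of elements of $X$). $D(X,A):=D(X)/D(A)$ is the quotient monoid, where $\alpha\sim\beta$ iff $\alpha+\xi=\beta+\eta$ for some $\xi,\eta\in D(A)$; thus $D(X,A)\cong D(X\setminus A)$. The canonical inclusion $i:X\to D(X,A)$ sends $x$ to the class of the formal sum $x$ (so $i(A)=\{0\}$). The $p$-Wasserstein distance $W_p[d,A]$ on $D(X,A)$ is $$W_p[d,A](x_1+\cdots+x_m,\,x_1'+\cdots+x_n')=\inf\big\|(d(x_k,x'_{\sigma(k)}))_{k=1}^{m+n}\big\|_p,$$ the infimum being over all $x_{m+1},\ldots,x_{m+n},x'_{n+1},\ldots,x'_{n+m}\in A$ and all permutations $\sigma\in\Sigma_{m+n}$. *)

(* Defs.v *)
From HB Require Import structures.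
From mathcomp Require Import all_boot all_order all_fingroup all_algebra generic_quotient.
From mathcomp Require Import finmap multiset.
From mathcomp Require Import all_classical all_reals all_analysis.
Set Implicit Arguments.
Unset Strict Implicit.
Unset Printing Implicit Defensive.
Import Order.TTheory GRing.Theory Num.Theory.
Local Open Scope quotient_scope.
Local Open Scope classical_set_scope.
Local Open Scope ring_scope.
Local Open Scope ereal_scope.

(* Only meaningful for 1 <= p; the empty tuple has norm 0 for every such p. *)
Definition pnorm (R : realType) (p : \bar R) (s : seq \bar R) : \bar R :=
  match p with
  | r%:E => (\sum_(x <- s) `|x| `^ r) `^ r^-1
  | +oo => \big[maxe/0]_(x <- s) `|x|
  | -oo => 0
  end.

Section metric.
Context (R : realType).

(* Extended pseudometric: d x y may be +oo, and d x y = 0 does not force x = y. *)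
Definition is_metric (X : Type) (d : X -> X -> \bar R) : Prop :=
  [/\ forall x y, 0 <= d x y,
      forall x, d x x = 0,
      forall x y, d x y = d y x &
      forall x y z, d x y <= d x z + d z y].

Definition metric_pair (X : Type) (d : X -> X -> \bar R) (A : set X) : Prop :=
  is_metric d /\ A !=set0.

Definition metric_map (X Y : Type) (dX : X -> X -> \bar R)
    (dY : Y -> Y -> \bar R) (f : X -> Y) : Prop :=
  forall x y, dY (f x) (f y) <= dX x y.

Definition pair_map (X Y : Type) (dX : X -> X -> \bar R) (A : set X)
    (dY : Y -> Y -> \bar R) (B : set Y) (f : X -> Y) : Prop :=
  metric_map dX dY f /\ f @` A `<=` B.

Definition subadditive_monoid (p : \bar R) (M : nmodType)
    (d : M -> M -> \bar R) : Prop :=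
  metric_pair d [set 0%R] /\
  forall a b a' b' : M,
    d (a + b)%R (a' + b')%R <= pnorm p [:: d a a'; d b b'].

End metric.

Definition free_monoid (X : choiceType) := {mset X}%mset.

Section free_monoid_theory.
Context (X : choiceType).

HB.instance Definition _ := Choice.on (free_monoid X).
HB.instance Definition _ := GRing.isNmodule.Build (free_monoid X)
  (@msetDA X) (@msetDC X) (@mset0D X).

End free_monoid_theory.

Section pnorm_theory.
Context (R : realType).
Context (p : \bar R) (T : eqType) (f : T -> \bar R).

Lemma perm_pnorm (s t : seq T) :
  perm_eq s t -> pnorm p (map f s) = pnorm p (map f t).
Proof.
by move=> st; case: p => [r| |] //=; rewrite !big_map (perm_big _ st).
Qed.

Lemma pnorm_filter_le (P : pred T) (s : seq T) : 1 <= p ->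
  pnorm p [seq f x | x <- s & P x] <= pnorm p (map f s).
Proof.
case: p => [r| |] //= hp; rewrite !big_map.
  have h0 (t : seq T) : 0 <= \sum_(i <- t) `|f i| `^ r.
    by apply: sume_ge0 => i _; exact: poweR_ge0.
  apply: gt0_ler_poweR; rewrite ?in_itv/= ?leey ?h0 ?andbT//.
    by rewrite invr_ge0 (le_trans ler01).
  elim: s => [|x s ih]; first by rewrite big_nil.
  rewrite [in leRHS]big_cons /=; case: ifP => _; rewrite ?big_cons ?leeD2l//.
  by rewrite (le_trans ih)// leeDr// poweR_ge0.
elim: s => [|x s ih] //=.
rewrite [in leRHS]big_cons; case: ifP => _; rewrite ?big_cons.
  by rewrite ge_max !le_max lexx ih orbT.
by rewrite le_max ih orbT.
Qed.

Lemma pnorm_cat0 (s t : seq T) : 1 <= p -> (forall x, x \in t -> f x = 0) ->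
  pnorm p (map f (s ++ t)) = pnorm p (map f s).
Proof.
move=> hp ht; case: p hp => [r| |] //= hp; rewrite !big_map.
  rewrite big_cat /= [X in _ + X]big1_seq ?adde0// => i /= /ht ->.
  by rewrite abse0 poweR0r// gt_eqF// (lt_le_trans ltr01).
elim: s => [|x s ih]; last by rewrite /= !big_cons ih.
rewrite big_nil /= big_seq; apply: big1_idem => [|i /ht ->]; last by rewrite abse0.
by rewrite /= maxxx.
Qed.

End pnorm_theory.

Section relative.
Context (X : choiceType) (A : set X).
Implicit Types u v w : free_monoid X.

Definition supported u : Prop := forall x : X, x \in (u : {mset X}%mset) -> A x.

Definition rel_eqv u v : bool :=
  `[< exists xi eta, [/\ supported xi, supported eta & (u + xi = v + eta)%R] >].

Lemma supportedD u v : supported u -> supported v -> supported (u + v)%R.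
Proof. by move=> hu hv x; rewrite in_msetD => /orP[/hu|/hv]. Qed.

Lemma supported0 : supported 0%R.
Proof. by move=> x; rewrite in_mset0. Qed.

Lemma rel_eqv_equiv : equiv_class_of rel_eqv.
Proof.
split=> [u|u v|v u w].
- by apply/asboolP; exists 0%R, 0%R; split=> //; exact: supported0.
- by apply/asboolP/asboolP => -[xi [eta [h1 h2 h]]]; exists eta, xi.
- move=> /asboolP[xi [eta [h1 h2 h]]] /asboolP[xi' [eta' [h1' h2' h']]].
  apply/asboolP; exists (xi + xi')%R, (eta' + eta)%R; split; [exact: supportedD..|].
  by rewrite addrA h addrAC h' addrA.
Qed.

Canonical rel_eqv_equivRel := EquivRelPack rel_eqv_equiv.

Definition rel_free := {eq_quot rel_eqv}.
HB.instance Definition _ : EqQuotient _ rel_eqv rel_free :=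
  EqQuotient.on rel_free.
HB.instance Definition _ := Choice.on rel_free.

Definition rel_add (a b : rel_free) : rel_free :=
  \pi_rel_free (repr a + repr b)%R.

Lemma pi_rel_eqvP u v : reflect
  (exists xi eta, [/\ supported xi, supported eta & (u + xi = v + eta)%R])
  (\pi_rel_free u == \pi_rel_free v).
Proof. by rewrite eqmodE; exact: asboolP. Qed.

Lemma rel_addE u v :
  rel_add (\pi_rel_free u) (\pi_rel_free v) = \pi_rel_free (u + v)%R.
Proof.
apply/eqP/pi_rel_eqvP.
have /eqP/pi_rel_eqvP[xi [eta [h1 h2 h]]] := reprK (\pi_rel_free u).
have /eqP/pi_rel_eqvP[xi' [eta' [h1' h2' h']]] := reprK (\pi_rel_free v).
exists (xi + xi')%R, (eta + eta')%R; split; [exact: supportedD..|].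
by rewrite addrACA h h' addrACA.
Qed.

Lemma rel_addA : associative rel_add.
Proof.
move=> a b c; rewrite -[a]reprK -[b]reprK -[c]reprK.
rewrite (rel_addE (repr b) (repr c)) (rel_addE (repr a) (repr b)).
by rewrite (rel_addE (repr a)) (rel_addE _ (repr c)) addrA.
Qed.

Lemma rel_addC : commutative rel_add.
Proof. by move=> a b; rewrite /rel_add addrC. Qed.

Lemma rel_add0 : left_id (\pi_rel_free 0%R) rel_add.
Proof. by move=> a; rewrite -[a]reprK (rel_addE 0%R (repr a)) add0r. Qed.

HB.instance Definition _ :=
  GRing.isNmodule.Build rel_free rel_addA rel_addC rel_add0.

Definition rel_incl (x : X) : rel_free := \pi_rel_free (msetn 1%N x).

Lemma sum_rel_incl (s : seq X) :
  (\sum_(x <- s) rel_incl x)%R = \pi_rel_free (seq_mset s).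
Proof.
elim: s => [|x s ih].
  rewrite big_nil; congr (\pi_rel_free _); apply/msetP => y.
  by rewrite mset_seqE mset0E.
by rewrite big_cons ih mset_cons [LHS]rel_addE.
Qed.

Lemma filter_mset_repr (s : seq X) : perm_eq
  [seq x <- enum_mset (repr (\pi_rel_free (seq_mset s)) : free_monoid X)
   | ~~ `[< A x >]]
  [seq x <- s | ~~ `[< A x >]].
Proof.
have /eqP/pi_rel_eqvP[xi [eta [h1 h2 h]]] := reprK (\pi_rel_free (seq_mset s)).
have fE (l : seq X) x : count_mem x [seq y <- l | ~~ `[< A y >]] =
    if `[< A x >] then 0%N else count_mem x l.
  rewrite count_filter; case: ifPn => hx.
    rewrite (@eq_count _ _ pred0) ?count_pred0// => y /=.
    by case: eqP => //= ->; rewrite hx.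
  by apply: eq_count => y /=; case: eqP => //= ->; rewrite hx.
apply/allP => x _ /=; rewrite !fE; case: asboolP => // nAx.
have : (x \notin (xi : {mset X}%mset)) /\ (x \notin (eta : {mset X}%mset)).
  by split; apply/negP; [move=> /h1|move=> /h2].
move/(congr1 (fun u : {mset X}%mset => u x)): h; rewrite !msetE2.
rewrite mset_seqE count_mem_mset => h [/mset_eq0P h3 /mset_eq0P h4].
by move: h; rewrite h3 h4 !addn0 => ->.
Qed.

End relative.

Section wasserstein.
Context (R : realType).
Context (p : \bar R) (X : choiceType) (d : X -> X -> \bar R) (A : set X).

(* [tcast] only identifies 'I_(n + m) with 'I_(m + n). *)
Definition wasserstein_sum (m n : nat) (x : m.-tuple X) (x' : n.-tuple X)
    : \bar R :=
  ereal_inf [set c | exists (a : n.-tuple X) (a' : m.-tuple X)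
      (sigma : {perm 'I_(m + n)}),
    [/\ forall k, A (tnth a k), forall k, A (tnth a' k) &
        c = pnorm p [seq d (tnth [tuple of x ++ a] k)
              (tnth (tcast (addnC n m) [tuple of x' ++ a']) (sigma k))
            | k : 'I_(m + n)]]].

(* Defined on chosen representatives; by [wassersteinE] the choice of how
   an element is written as a formal sum does not matter. *)
Definition wasserstein (u v : rel_free A) : \bar R :=
  wasserstein_sum (in_tuple (enum_mset (repr u : free_monoid X)))
                  (in_tuple (enum_mset (repr v : free_monoid X))).

Let nA := [pred x | ~~ `[< A x >]].

Let matching (s t : seq X) (w : seq (X * X)) : Prop :=
  perm_eq [seq x <- map fst w | nA x] [seq x <- s | nA x] /\
  perm_eq [seq x <- map snd w | nA x] [seq x <- t | nA x].

Let cost (w : seq (X * X)) : \bar R := pnorm p [seq d z.1 z.2 | z <- w].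

Let perm_realize (T : eqType) (f : T -> X) (w : seq T) (l : seq X) :
  perm_eq l (map f w) -> exists2 w', perm_eq w' w & map f w' = l.
Proof.
case: w => [|z w].
  by move/perm_nilP ->; exists [::].
move=> /(perm_iotaP (f z))[Is hIs ->]; exists (map (nth z (z :: w)) Is).
  have {2}-> : z :: w = map (nth z (z :: w)) (iota 0 (size (z :: w))).
    by rewrite map_nth_iota0// take_size.
  by apply: perm_map; rewrite size_map in hIs.
rewrite -map_comp; apply/eq_in_map => i; rewrite (perm_mem hIs) mem_iota add0n.
by rewrite size_map => /andP[_ hi]; rewrite /= -[LHS](nth_map z (f z)).
Qed.

Let literal_matching m n (x : m.-tuple X) (x' : n.-tuple X) a a'
    (sigma : {perm 'I_(m + n)}) :
  (forall k, A (tnth a k)) -> (forall k, A (tnth a' k)) ->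
  exists2 w, matching x x' w &
    cost w = pnorm p [seq d (tnth [tuple of x ++ a] k)
              (tnth (tcast (addnC n m) [tuple of x' ++ a']) (sigma k))
            | k : 'I_(m + n)].
Proof.
move=> ha ha'.
have nA0 l (b : l.-tuple X) : (forall k, A (tnth b k)) -> [seq x <- b | nA x] = [::].
  move=> hb; apply/eqP; rewrite -[_ == _]negbK -has_filter; apply/hasPn => y.
  by move=> /tnthP[k ->]; rewrite /= negbK asboolT.
exists [seq (tnth [tuple of x ++ a] k,
  tnth (tcast (addnC n m) [tuple of x' ++ a']) (sigma k)) | k : 'I_(m + n)].
  split; rewrite -map_comp.
    rewrite (_ : map _ _ = x ++ a); first by rewrite filter_cat (nA0 _ a)// cats0.
    by rewrite -[RHS](map_tnth_enum [tuple of x ++ a]) enumT; apply: eq_map.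
  set T := tcast _ _.
  have TE : T = x' ++ a' :> seq X by rewrite val_tcast.
  rewrite -[[seq x <- x' | _]]cats0 -(nA0 _ a')// -filter_cat -TE.
  apply: perm_filter.
  rewrite (_ : map _ _ = [seq tnth T k | k <- map sigma (enum 'I_(m + n))]).
    rewrite -[X in perm_eq _ X](map_tnth_enum T); apply: perm_map.
    apply: uniq_perm => [||k]; first by rewrite map_inj_uniq ?enum_uniq//; exact: perm_inj.
      exact: enum_uniq.
    rewrite [RHS]mem_enum inE -[k](permKV sigma).
    by rewrite map_f// mem_enum.
  by rewrite -[RHS]map_comp enumT.
by rewrite /cost -map_comp.
Qed.

Context (hp : 1 <= p) (hd : forall x, d x x = 0) (hA : A !=set0).

Let matching_literal m n (x : m.-tuple X) (x' : n.-tuple X) w :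
  matching x x' w ->
  exists a a' (sigma : {perm 'I_(m + n)}),
   [/\ forall k, A (tnth a k), forall k, A (tnth a' k) &
       pnorm p [seq d (tnth [tuple of x ++ a] k)
              (tnth (tcast (addnC n m) [tuple of x' ++ a']) (sigma k))
            | k : 'I_(m + n)] <= cost w].
Proof.
have [pt Apt] := hA.
move=> [hx hx'].
pose w1 := [seq z <- w | nA z.1 || nA z.2].
have w1_1 : [seq x <- map fst w1 | nA x] = [seq x <- map fst w | nA x].
  rewrite !filter_map -filter_predI; congr map; apply: eq_filter => z /=.
  by case: `[< A z.1 >].
have w1_2 : [seq x <- map snd w1 | nA x] = [seq x <- map snd w | nA x].
  rewrite !filter_map -filter_predI; congr map; apply: eq_filter => z /=.
  by case: `[< A z.2 >]; rewrite ?orbT ?orbF.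
rewrite -w1_1 in hx; rewrite -w1_2 in hx'.
pose cA := [pred x | ~~ nA x].
have cAP y : cA y -> A y by rewrite /= negbK => /asboolP.
pose a0 := [seq x <- map fst w1 | cA x].
pose b0 := [seq x <- map snd w1 | cA x].
pose sA := [seq y <- x | cA y].
pose tA := [seq y <- x' | cA y].
have cs (Q : pred X) (l : seq X) :
    (count Q l = count Q [seq y <- l | nA y] + count Q [seq y <- l | cA y])%N.
  rewrite -count_cat; apply: esym; apply: (elimT seq.permP).
  by rewrite (perm_filterC nA).
have ss (l : seq X) :
    (size l = size [seq y <- l | nA y] + size [seq y <- l | cA y])%N.
  by rewrite -!count_predT -cs.
have hx1 := perm_size hx; have hx'1 := perm_size hx'.
have := ss x; have := ss x'; have := ss (map fst w1); have := ss (map snd w1).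
rewrite !size_map !size_tuple -/a0 -/b0 -/sA -/tA hx1 hx'1 => e1 e2 e3 e4.
have lea0 : (size a0 <= size [seq y <- x' | nA y])%N.
  rewrite -hx'1 /a0 !filter_map !size_map /w1 -!filter_predI !size_filter.
  by apply: sub_count => z /=; case: `[< A z.1 >]; case: `[< A z.2 >].
pose k := (size [seq y <- x' | nA y] - size a0)%N.
pose D := sA ++ tA ++ nseq k pt.
pose w2 := w1 ++ [seq (y, y) | y <- D].
pose a := a0 ++ tA ++ nseq k pt.
pose a' := b0 ++ sA ++ nseq k pt.
have sza : size a = n by rewrite !size_cat size_nseq /k addnCA subnKC// addnC; exact: esym e3.
have sza' : size a' = m.
  apply: etrans (esym e4); rewrite !size_cat size_nseq /k addnCA [RHS]addnC.
  by congr addn; rewrite addnBA// [(size b0 + _)%N]addnC -e1 e2 addnK.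
have inA (l1 l2 l3 : seq X) : (forall y, y \in [seq y <- l1 | cA y] ++
    [seq y <- l2 | cA y] ++ nseq k pt -> A y).
  move=> y; rewrite !mem_cat !mem_filter mem_nseq.
  by case/or3P => [/andP[/cAP]|/andP[/cAP]|/andP[_ /eqP ->]].
have mD (f : X * X -> X) : (forall y, f (y, y) = y) -> map f [seq (y, y) | y <- D] = D.
  by move=> hf; rewrite -map_comp -[RHS]map_id; apply: eq_map => y /=.
have p1 : perm_eq (x ++ a) (map fst w2).
  apply/seq.permP => Q; rewrite map_cat mD// !count_cat (cs Q x) (cs Q (map fst w1)).
  by rewrite (seq.permP hx) addnACA.
have p2 : perm_eq (x' ++ a') (map snd w2).
  apply/seq.permP => Q; rewrite map_cat mD// !count_cat (cs Q x') (cs Q (map snd w1)).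
  rewrite (seq.permP hx') -/b0 -/tA addnACA; congr addn.
  by rewrite addnCA.
have [w3 p3 e3'] := perm_realize p1.
have sz3 : size w3 == (m + n)%N.
  by rewrite -(size_map fst) e3' size_cat size_tuple sza.
pose W := Tuple sz3.
pose ta := tcast sza (in_tuple a); pose ta' := tcast sza' (in_tuple a').
have taE : ta = a :> seq X by rewrite val_tcast.
have taE' : ta' = a' :> seq X by rewrite val_tcast.
have : perm_eq (map_tuple snd W) (tcast (addnC n m) [tuple of x' ++ ta']).
  rewrite val_tcast /= taE' perm_sym (perm_trans p2)//.
  by apply: perm_map; rewrite perm_sym.
case/tuple_permP => sigma hsigma.
exists ta, ta', sigma; split.
- by move=> i; apply: (inA (map fst w1) x' [::]); rewrite -/(a) -taE mem_tnth.
- by move=> i; apply: (inA (map snd w1) x [::]); rewrite -/(a') -taE' mem_tnth.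
rewrite (_ : [seq _ | k : 'I_(m + n)] = [seq d z.1 z.2 | z <- W]).
  rewrite (@perm_pnorm _ _ _ (fun z => d z.1 z.2) _ _ p3) /w2 pnorm_cat0//.
    exact: pnorm_filter_le.
  by move=> z /mapP[y _ ->].
rewrite -(map_tnth_enum W); apply: etrans (map_comp _ _ _).
rewrite /image_mem; apply: eq_map => i /=.
congr d.
  rewrite (_ : [tuple of x ++ ta] = map_tuple fst W) ?tnth_map//.
  by apply: val_inj; rewrite /= taE e3'.
have hs : map_tuple snd W =
    [tuple tnth (tcast (addnC n m) [tuple of x' ++ ta']) (sigma i) | i < m + n].
  exact: val_inj.
by have := congr1 (fun t => tnth t i) hs; rewrite tnth_map tnth_mktuple => <-.
Qed.

Let wasserstein_sum_matching m n (x : m.-tuple X) (x' : n.-tuple X) :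
  wasserstein_sum x x' = ereal_inf [set cost w | w in matching x x'].
Proof.
apply/le_anti/andP; split.
  apply: le_ereal_inf_tmp => _ [w hw <-].
  have [a [a' [sigma [h1 h2 h3]]]] := matching_literal hw.
  by apply: le_trans h3; apply: ereal_inf_lbound; exists a, a', sigma.
apply: le_ereal_inf_tmp => _ [a [a' [sigma [h1 h2 ->]]]].
have [w hw <-] := literal_matching x x' sigma h1 h2.
by apply: ereal_inf_lbound; exists w.
Qed.

Lemma wassersteinE m n (x : m.-tuple X) (x' : n.-tuple X) :
  wasserstein (\sum_(y <- x) rel_incl A y)%R (\sum_(y <- x') rel_incl A y)%R =
  wasserstein_sum x x'.
Proof.
rewrite /wasserstein !wasserstein_sum_matching !sum_rel_incl.
congr ereal_inf; congr image; apply/funext => w; apply/propext.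
have h1 := filter_mset_repr A x; have h2 := filter_mset_repr A x'.
rewrite /matching /=; split=> -[e1 e2]; split.
- by apply: perm_trans e1 h1.
- by apply: perm_trans e2 h2.
- by apply: perm_trans e1 _; rewrite perm_sym.
- by apply: perm_trans e2 _; rewrite perm_sym.
Qed.

End wasserstein.

Arguments wasserstein {R} p {X} d A u v.

(* Main.v *)
Require Import Defs.
From mathcomp Require Import all_boot all_order all_fingroup all_algebra.
From mathcomp Require Import generic_quotient finmap multiset.
From mathcomp Require Import all_classical all_reals all_analysis.
Set Implicit Arguments.
Unset Strict Implicit.
Unset Printing Implicit Defensive.
Import Order.TTheory GRing.Theory Num.Theory.
Local Open Scope classical_set_scope.
Local Open Scope ring_scope.
Local Open Scope ereal_scope.

(** The proof rests on a description of the Wasserstein distance that mentions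
neither representatives nor padding by points of [A].  A coupling of two
classes [u] and [v] is a finite list [w] of pairs of points such that the sum
of the classes of the first components is [u] and that of the second
components is [v]; its cost is the [p]-norm of the list of the distances
within the pairs.  The distance from [u] to [v] is the infimum of the costs of
their couplings ([wasserstein_coupling]): points of [A] have class [0], so a
coupling may contain as many of them as one likes.

Each property of the distance then comes from an operation on couplings.
Diagonal pairs give reflexivity and swapping the components gives symmetry.
Concatenating two lists couples the sums, and the [p]-norm of a concatenation
is the [p]-norm of the two [p]-norms, which gives [p]-subadditivity.  The
triangle inequality comes from gluing ([coupling_glue]): the middle parts of a
coupling of [u] with [v] and of a coupling of [v] with [t] agree, as
multisets, up to points of [A]; diagonal pairs over such points cost nothing,
so after adding them and reordering, the two lists can be composed pair by
pair.  The triangle inequality of [d] and Minkowski's inequality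
([minkowski_seq]) bound the cost of the composite.

For the universal property, [phi] vanishes on [A], so the sum of its values
over a formal sum depends only on the class of that sum; this is the extension
[rel_lift], and it is the only additive one because the classes of points
generate.  It does not increase distances, because iterating the subadditivity
of the target bounds the distance between the two sums attached to a coupling
by the cost of that coupling ([subadditive_sum]). *)

(** * The p-norm of finite lists *)

Section pnorm_lemmas.
Context (R : realType) (p : \bar R) (p1 : 1 <= p).
Implicit Types (a b : \bar R) (s t : seq \bar R).

Let real_exponent (r : R) : 1 <= r%:E -> (0 < r)%R /\ (0 < r^-1)%R.
Proof. by rewrite lee_fin => r1; rewrite invr_gt0 (lt_le_trans ltr01 r1). Qed.

Lemma pnorm_nil : pnorm p [::] = 0.
Proof.
case: p p1 => [r /real_exponent[r0 r0']| _|] //=; rewrite big_nil//.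
by rewrite poweR0r// gt_eqF.
Qed.

Lemma pnorm_ge0 s : 0 <= pnorm p s.
Proof.
case: p p1 => [r _| _|] //=; first exact: poweR_ge0.
by elim: s => [|a s ih]; rewrite ?big_nil// big_cons le_max ih orbT.
Qed.

Lemma pnorm1 a : 0 <= a -> pnorm p [:: a] = a.
Proof.
move=> a0; case: p p1 => [r /real_exponent[r0 r0']| _|] //=.
  by rewrite big_seq1 gee0_abs// -poweRrM mulfV ?poweRe1// gt_eqF.
by rewrite big_cons big_nil gee0_abs//; apply/max_idPl.
Qed.

(** This is what makes [p]-subadditivity of a binary sum equivalent to
[p]-subadditivity of finite sums. *)
Lemma pnorm_cat s t : pnorm p (s ++ t) = pnorm p [:: pnorm p s; pnorm p t].
Proof.
case: p p1 => [r /real_exponent[r0 r0']| _|] //=.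
  rewrite big_cat /= big_cons big_seq1 !gee0_abs ?poweR_ge0//.
  rewrite -!poweRrM mulVf ?gt_eqF//.
  by rewrite !poweRe1// sume_ge0// => i _; rewrite poweR_ge0.
have maxe0 (u : seq \bar R) : 0 <= \big[maxe/0]_(x <- u) `|x|.
  by elim: u => [|a u ih]; rewrite ?big_nil// big_cons le_max ih orbT.
rewrite !big_cons big_nil !gee0_abs// (max_idPl (maxe0 t)).
elim: s => [|a s ih] /=.
  by rewrite big_nil; apply/esym/max_idPr.
by rewrite !big_cons ih maxA.
Qed.

Lemma le_pnorm (T : Type) (f g : T -> \bar R) (w : seq T) :
  (forall x, 0 <= f x) -> (forall x, f x <= g x) ->
  pnorm p (map f w) <= pnorm p (map g w).
Proof.
move=> f0 fg; have g0 x : 0 <= g x := le_trans (f0 x) (fg x).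
case: p p1 => [r /real_exponent[r0 r0']| _|] //=; rewrite !big_map.
  have ge0 (h : T -> \bar R) : 0 <= \sum_(x <- w) `|h x| `^ r.
    by apply: sume_ge0 => i _; rewrite poweR_ge0.
  apply: (gt0_ler_poweR (ltW r0')); rewrite ?in_itv/= ?leey ?ge0//.
  apply: lee_sum => i _; rewrite !gee0_abs//.
  by apply: (gt0_ler_poweR (ltW r0)); rewrite ?in_itv/= ?leey ?f0 ?g0 ?fg.
elim: w => [|a w ih]; first by rewrite !big_nil.
rewrite !big_cons ge_max !le_max !gee0_abs//.
by rewrite fg/= ih orbT.
Qed.

Lemma le_pnorm2 a b a' b' : 0 <= a -> 0 <= b -> a <= a' -> b <= b' ->
  pnorm p [:: a; b] <= pnorm p [:: a'; b'].
Proof.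
move=> a0 b0 aa' bb'.
have := @le_pnorm bool (fun i => if i then a else b)
  (fun i => if i then a' else b') [:: true; false].
by apply => -[].
Qed.

Lemma mem_pnorm a s : 0 <= a -> a \in s -> a <= pnorm p s.
Proof.
move=> a0; elim: s => // b s ih; rewrite inE -cat1s pnorm_cat => abs.
(* [pnorm_filter_le] is used on the list of the two norms, indexed by [bool]. *)
pose f (i : bool) := if i then pnorm p [:: b] else pnorm p s.
have le2 P := pnorm_filter_le f P [:: true; false] p1.
case/orP: abs => [/eqP ab|/ih as_].
  by have := le2 id; rewrite /= -ab !(pnorm1 a0).
apply: (le_trans as_).
by have := le2 negb; rewrite /= (pnorm1 (pnorm_ge0 s)).
Qed.

(** For a real exponent this is Minkowski's inequality for the counting measure
on [nat], applied to the two lists of values continued by [0].  That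
inequality is about real-valued functions, so infinite entries are treated
separately: they make the right-hand side infinite. *)
Lemma minkowski_seq (T : eqType) (f g : T -> \bar R) (w : seq T) :
  (forall x, 0 <= f x) -> (forall x, 0 <= g x) ->
  pnorm p [seq f x + g x | x <- w] <= pnorm p (map f w) + pnorm p (map g w).
Proof.
move=> f0 g0.
have [ffin|] := boolP (all (fun x => f x \is a fin_num) w); last first.
  move=> /allPn[x xw]; rewrite ge0_fin_numE// -leNgt leye_eq => /eqP fx.
  suff -> : pnorm p (map f w) = +oo.
    by rewrite addye ?leey// gt_eqF// (lt_le_trans (ltNyr 0)) ?pnorm_ge0.
  by apply/eqP; rewrite -leye_eq mem_pnorm// -fx map_f.
have [gfin|] := boolP (all (fun x => g x \is a fin_num) w); last first.
  move=> /allPn[x xw]; rewrite ge0_fin_numE// -leNgt leye_eq => /eqP gx.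
  suff -> : pnorm p (map g w) = +oo.
    by rewrite addey ?leey// gt_eqF// (lt_le_trans (ltNyr 0)) ?pnorm_ge0.
  by apply/eqP; rewrite -leye_eq mem_pnorm// -gx map_f.
case: p p1 => [r r1| _|] //=; last first.
  rewrite !big_map; elim: w {ffin gfin} => [|a w ih].
    by rewrite !big_nil adde0.
  rewrite !big_cons ge_max !gee0_abs ?adde_ge0//.
  rewrite leeD ?le_max ?lexx//=.
  by rewrite (le_trans ih)// leeD// le_max lexx orbT.
have [r0 r0'] := real_exponent r1.
case: w ffin gfin => [|x0 w0]; first by rewrite /= !big_nil poweR0r ?gt_eqF ?adde0.
move: (x0 :: w0) => w ffin gfin.
pose ext (h : T -> \bar R) n := if (n < size w)%N then fine (h (nth x0 w n)) else 0%R.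
have extE (h : T -> \bar R) : all (fun x => h x \is a fin_num) w ->
    'N[counting]_r%:E[EFin \o ext h] = pnorm r%:E (map h w).
  move=> hfin; rewrite Lnorm_counting// (nneseries_split 0 (size w)); last first.
    by move=> k _; rewrite poweR_ge0.
  rewrite add0n eseries0 ?adde0; last first.
    by move=> n wn _; rewrite /= /ext ltnNge wn/= normr0 powR0// gt_eqF.
  rewrite /pnorm big_map (big_nth x0); congr (_ `^ _).
  apply: eq_big_nat => i /andP[_ iw].
  by rewrite /comp /ext iw fineK// (allP hfin)// mem_nth.
have fgfin : all (fun x => f x + g x \is a fin_num) w.
  by apply/allP => x xw; rewrite fin_numD (allP ffin)// (allP gfin).
rewrite -[leLHS]/(pnorm r%:E _) -[leRHS]/(pnorm r%:E _ + pnorm r%:E _).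
rewrite -!extE//.
rewrite (_ : ext _ = (ext f \+ ext g)%R); first exact: minkowski_EFin.
apply/funext => n /=; rewrite /ext; case: ifPn => nw; last by rewrite addr0.
by rewrite fineD ?(allP ffin) ?(allP gfin) ?mem_nth.
Qed.

Lemma pnorm2_leD a b : 0 <= a -> 0 <= b -> pnorm p [:: a; b] <= a + b.
Proof.
move=> a0 b0.
have h (c : \bar R) : 0 <= c -> pnorm p [:: c; 0] = c /\ pnorm p [:: 0; c] = c.
  move=> c0.
  have := pnorm_cat [:: c] [::]; have := pnorm_cat [::] [:: c].
  by rewrite cats0 pnorm_nil !pnorm1.
(* [(a, b) = (a, 0) + (0, b)] *)
have := @minkowski_seq bool (fun i => if i then a else 0)
  (fun i => if i then 0 else b) [:: true; false].
rewrite /= adde0 add0e (h a a0).1 (h b b0).2.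
by apply => -[].
Qed.

End pnorm_lemmas.

(** * The relative free monoid *)

Section rel_free_theory.
Context (X : choiceType) (A : set X).

Lemma rel_inclA x : A x -> rel_incl A x = 0%R.
Proof.
move=> Ax; apply/eqP/pi_rel_eqvP; exists 0%R, (msetn 1%N x).
split; [exact: supported0 | | by rewrite addr0 add0r].
by move=> y; rewrite in_msetn /= => /eqP ->.
Qed.

Lemma rel_free_sum (u : rel_free A) :
  u = (\sum_(x <- enum_mset (repr u : free_monoid X)) rel_incl A x)%R.
Proof. by rewrite sum_rel_incl seq_mset_id reprK. Qed.

(** The equivalence of formal sums in terms of lists, the form in which
couplings provide them. *)
Lemma eq_sum_rel_incl (s t : seq X) :
  (\sum_(x <- s) rel_incl A x)%R = (\sum_(x <- t) rel_incl A x)%R ->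
  exists a b, [/\ forall x, x \in a -> A x, forall x, x \in b -> A x &
                  perm_eq (s ++ a) (t ++ b)].
Proof.
rewrite !sum_rel_incl => /eqP/pi_rel_eqvP[xi [eta [xiA etaA e]]].
exists (enum_mset xi), (enum_mset eta); split; [exact: xiA|exact: etaA|].
apply/eq_seq_msetP; have catE (l : seq X) (v : {mset X}%mset) :
    seq_mset (l ++ enum_mset v) = (seq_mset l `+` v)%mset.
  by apply/msetP => x; rewrite msetE2 !mset_seqE count_cat count_mem_mset.
by rewrite !catE.
Qed.

End rel_free_theory.

Lemma perm_map_lift (S T : eqType) (f : S -> T) (l : seq T) (s : seq S) :
  perm_eq l (map f s) -> exists2 s', perm_eq s' s & map f s' = l.
Proof.
case: s => [/perm_nilP ->|z s]; first by exists [::].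
move=> /(perm_iotaP (f z))[Is IsE ->]; rewrite size_map in IsE.
exists (map (nth z (z :: s)) Is).
  by rewrite -[X in perm_eq _ X](mkseq_nth z) perm_map.
rewrite -map_comp; apply/eq_in_map => i; rewrite (perm_mem IsE) mem_iota.
by rewrite add0n => /andP[_ ilt]; rewrite /= -[LHS](nth_map z (f z)).
Qed.

(** * Couplings and the Wasserstein distance *)

Section couplings.
Context (R : realType) (p : \bar R) (X : choiceType) (d : X -> X -> \bar R).
Context (A : set X) (p1 : 1 <= p) (dXA : metric_pair d A).
Implicit Types (u v t : rel_free A) (w : seq (X * X)).

Let d_ge0 x y : 0 <= d x y. Proof. by case: dXA => -[]. Qed.
Let d_refl x : d x x = 0. Proof. by case: dXA => -[]. Qed.
Let d_sym x y : d x y = d y x. Proof. by case: dXA => -[]. Qed.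
Let d_triangle x y z : d x y <= d x z + d z y. Proof. by case: dXA => -[]. Qed.

Definition coupling u v w : Prop :=
  (\sum_(z <- w) rel_incl A z.1)%R = u /\ (\sum_(z <- w) rel_incl A z.2)%R = v.

Definition cost w : \bar R := pnorm p [seq d z.1 z.2 | z <- w].

Definition diag (s : seq X) : seq (X * X) := [seq (x, x) | x <- s].

Lemma cost_cat w w' : cost (w ++ w') = pnorm p [:: cost w; cost w'].
Proof. by rewrite /cost map_cat pnorm_cat. Qed.

Lemma cost_cat_diag w s : cost (w ++ diag s) = cost w.
Proof. by rewrite /cost pnorm_cat0// => _ /mapP[x _ ->]. Qed.

Lemma perm_cost w w' : perm_eq w w' -> cost w = cost w'.
Proof. exact: perm_pnorm. Qed.

Lemma coupling_cat u v u' v' w w' :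
  coupling u v w -> coupling u' v' w' -> coupling (u + u')%R (v + v')%R (w ++ w').
Proof. by move=> [<- <-] [<- <-]; rewrite /coupling !big_cat. Qed.

(** An admissible matching, padding included, is itself a coupling, because the
padding has class [0].  Conversely, the two component lists of a coupling of
length [n] represent [u] and [v] and can be matched by the identity; padding
both with [n] copies of one point of [A] adds only zero distances. *)
Lemma wasserstein_coupling u v :
  wasserstein p d A u v = ereal_inf [set cost w | w in coupling u v].
Proof.
have [[_ _ _ _] [pt Apt]] := dXA.
apply/le_anti/andP; split.
  apply: le_ereal_inf_tmp => _ [w [<- <-] <-].
  pose x := map_tuple fst (in_tuple w); pose y := map_tuple snd (in_tuple w).
  have sE (f : X * X -> X) : (\sum_(z <- w) rel_incl A (f z))%R =
      (\sum_(z <- map f w) rel_incl A z)%R by rewrite big_map.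
  rewrite (sE fst) (sE snd).
  rewrite (@wassersteinE _ _ _ _ _ p1 d_refl _ _ _ x y); last by exists pt.
  pose a := nseq_tuple (size w) pt.
  apply: ereal_inf_lbound; exists a, a, 1%g; split.
  - by move=> k; rewrite tnth_nseq.
  - by move=> k; rewrite tnth_nseq.
  have sz : size (w ++ diag (nseq (size w) pt)) == (size w + size w)%N.
    by rewrite size_cat size_map size_nseq.
  pose W := Tuple sz.
  rewrite -(cost_cat_diag w (nseq (size w) pt)) /cost -[w ++ _]/(tval W).
  rewrite -{1}(map_tnth_enum W) -map_comp; congr pnorm; rewrite /image_mem.
  apply: eq_map => k /=; rewrite perm1; congr d.
    rewrite -(tnth_map fst); congr tnth; apply: val_inj => /=.
    by rewrite map_cat -map_comp map_id.
  rewrite -(tnth_map snd); congr tnth; apply: val_inj => /=.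
  by rewrite val_tcast /= map_cat -map_comp map_id.
apply: le_ereal_inf_tmp => _ [a [a' [sigma [aA a'A ->]]]].
apply: ereal_inf_lbound.
set xa := [tuple of _ ++ a]; set ya := tcast _ _.
exists [seq (tnth xa k, tnth ya (sigma k)) | k : 'I__]; last first.
  by rewrite /cost -map_comp.
have sumA n (b : n.-tuple X) : (forall k, A (tnth b k)) ->
    (\sum_(x <- b) rel_incl A x)%R = 0%R.
  by move=> bA; rewrite big1_seq// => x /andP[_ /tnthP[k ->]]; rewrite rel_inclA.
split; rewrite big_map big_enum /=.
  rewrite -(big_tuple _ _ xa xpredT (rel_incl A)) /=.
  by rewrite big_cat /= sumA// addr0 -rel_free_sum.
rewrite -(@reindex_inj _ _ _ _ _ xpredT (fun k => rel_incl A (tnth ya k))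
  (@perm_inj _ sigma)).
rewrite -(big_tuple _ _ ya xpredT (rel_incl A)) /= val_tcast /=.
by rewrite big_cat /= sumA// addr0 -rel_free_sum.
Qed.

Lemma wasserstein_le u v w : coupling u v w -> wasserstein p d A u v <= cost w.
Proof.
by move=> uvw; rewrite wasserstein_coupling; apply: ereal_inf_lbound; exists w.
Qed.

Lemma wasserstein_ge0 u v : 0 <= wasserstein p d A u v.
Proof.
rewrite wasserstein_coupling; apply: le_ereal_inf_tmp => _ [w _ <-].
exact: pnorm_ge0.
Qed.

(** Send everything to one point of [A]. *)
Lemma coupling_exists u v : exists w, coupling u v w.
Proof.
have [_ [pt /rel_inclA pt0]] := dXA.
exists ([seq (x, pt) | x <- enum_mset (repr u : free_monoid X)] ++
        [seq (pt, y) | y <- enum_mset (repr v : free_monoid X)]).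
split; rewrite big_cat !big_map /= -rel_free_sum pt0.
  by rewrite big1// addr0.
by rewrite big1// add0r.
Qed.

(** The infimum need not be attained; when it is infinite, any coupling will
do. *)
Lemma coupling_approx u v (e : R) : (0 < e)%R ->
  exists2 w, coupling u v w & cost w <= wasserstein p d A u v + e%:E.
Proof.
move=> e0; have W0 := wasserstein_ge0 u v.
have [Wy|Wfin] := eqVneq (wasserstein p d A u v) +oo.
  by have [w uvw] := coupling_exists u v; exists w; rewrite ?Wy// addye// leey.
have : ereal_inf [set cost w | w in coupling u v] \is a fin_num.
  by rewrite -wasserstein_coupling ge0_fin_numE// ltey.
move/(lb_ereal_inf_adherent e0) => [_ [w uvw <-]].
by rewrite -wasserstein_coupling => /ltW; exists w.
Qed.

Lemma wasserstein_refl u : wasserstein p d A u u = 0.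
Proof.
apply/le_anti/andP; split; last exact: wasserstein_ge0.
rewrite -(pnorm_nil p1) -[leRHS]/(cost [::]).
rewrite -(cost_cat_diag [::] (enum_mset (repr u : free_monoid X))).
by apply: wasserstein_le; split; rewrite big_map -rel_free_sum.
Qed.

Lemma wasserstein_sym u v : wasserstein p d A u v = wasserstein p d A v u.
Proof.
suff le_sym a b : wasserstein p d A a b <= wasserstein p d A b a.
  by apply/le_anti; rewrite !le_sym.
rewrite [leRHS]wasserstein_coupling.
apply: le_ereal_inf_tmp => _ [w [bw aw] <-].
have -> : cost w = cost [seq (z.2, z.1) | z <- w].
  by rewrite /cost -map_comp; congr pnorm; apply: eq_map => z /=; rewrite d_sym.
by apply: wasserstein_le; split; rewrite big_map.
Qed.

(** Once diagonal pairs over points of [A] make the second components of [w1]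
and the first components of [w2] equal as multisets, [w2] can be reordered so
that they are equal as lists; then [z.1] and [z.2] in the zipped list share a
midpoint. *)
Lemma coupling_glue u v t w1 w2 : coupling u v w1 -> coupling v t w2 ->
  exists2 w, coupling u t w & cost w <= cost w1 + cost w2.
Proof.
move=> [<- vE] [vE' <-].
have [|a [b [aA bA ab]]] := @eq_sum_rel_incl _ A (map snd w1) (map fst w2).
  by rewrite !big_map vE vE'.
have diag1 s : map fst (diag s) = s by rewrite -map_comp map_id.
have diag2 s : map snd (diag s) = s by rewrite -map_comp map_id.
rewrite -[X in perm_eq (_ ++ X)]diag2 -[X in perm_eq _ (_ ++ X)]diag1 -!map_cat in ab.
have [w2' w2'E e] := perm_map_lift ab.
rewrite -(cost_cat_diag w1 a) -(cost_cat_diag w2 b) -(perm_cost w2'E).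
have sumD s (f : X * X -> X) : (forall x, f (x, x) = x) ->
    (forall x, x \in s -> A x) -> (\sum_(z <- diag s) rel_incl A (f z))%R = 0%R.
  move=> fE sA; rewrite big_map big1_seq// => x /andP[_ xs].
  by rewrite fE (rel_inclA (sA x xs)).
have -> : (\sum_(z <- w1) rel_incl A z.1)%R =
    (\sum_(z <- w1 ++ diag a) rel_incl A z.1)%R.
  by rewrite big_cat /= sumD// addr0.
have -> : (\sum_(z <- w2) rel_incl A z.2)%R = (\sum_(z <- w2') rel_incl A z.2)%R.
  by rewrite (perm_big _ w2'E) big_cat /= sumD// addr0.
move: (w1 ++ diag a) w2' e {w2'E ab vE} => w1' w2' e.
have sz : size w1' = size w2' by rewrite -(size_map snd) -e size_map.
pose ts := zip w1' w2'.
have ts1 : map fst ts = w1' by apply: unzip1_zip; rewrite sz.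
have ts2 : map snd ts = w2' by apply: unzip2_zip; rewrite sz.
have mid : {in ts, forall z, z.1.2 = z.2.1}.
  by move: e; rewrite -ts1 -ts2 -!map_comp => /eq_in_map h z /h.
exists [seq (z.1.1, z.2.2) | z <- ts].
  by rewrite -ts1 -ts2; split; rewrite !big_map.
rewrite -ts1 -ts2 /cost -!map_comp.
pose f1 (z : (X * X) * (X * X)) := d z.1.1 z.1.2.
pose f2 (z : (X * X) * (X * X)) := d z.2.1 z.2.2.
apply: (le_trans _ (@minkowski_seq _ _ p1 _ f1 f2 ts
  (fun=> d_ge0 _ _) (fun=> d_ge0 _ _))).
have -> : [seq f1 z + f2 z | z <- ts] =
    [seq d z.1.1 z.1.2 + d z.1.2 z.2.2 | z <- ts].
  by apply/eq_in_map => z /mid; rewrite /f1 /f2 => ->.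
by apply: (le_pnorm p1) => z /=.
Qed.

Lemma wasserstein_triangle u v t :
  wasserstein p d A u v <= wasserstein p d A u t + wasserstein p d A t v.
Proof.
apply/lee_addgt0Pr => e e0; have e2 : (0 < e / 2)%R by rewrite divr_gt0.
have [w1 utw1 le1] := coupling_approx u t e2.
have [w2 tvw2 le2] := coupling_approx t v e2.
have [w uvw le] := coupling_glue utw1 tvw2.
rewrite (le_trans (wasserstein_le uvw))// (le_trans le)//.
by rewrite (le_trans (leeD le1 le2))// addeACA -EFinD -splitr.
Qed.

(** Couplings that are optimal up to [e / 2] are concatenated; the two errors
leave the norm by Minkowski's inequality and add up to at most [e]. *)
Lemma wasserstein_subadditive u v u' v' :
  wasserstein p d A (u + v)%R (u' + v')%R <=
  pnorm p [:: wasserstein p d A u u'; wasserstein p d A v v'].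
Proof.
apply/lee_addgt0Pr => e e0; have e2 : (0 < e / 2)%R by rewrite divr_gt0.
have [w1 cw1 le1] := coupling_approx u u' e2.
have [w2 cw2 le2] := coupling_approx v v' e2.
rewrite (le_trans (wasserstein_le (coupling_cat cw1 cw2)))// cost_cat.
rewrite (le_trans (le_pnorm2 p1 _ _ le1 le2)) ?pnorm_ge0//.
have := @minkowski_seq _ _ p1 bool
  (fun i => if i then wasserstein p d A u u' else wasserstein p d A v v')
  (fun=> (e / 2)%:E) [:: true; false].
move=> /= /(_ _ _)/le_trans; apply => //.
- by case; exact: wasserstein_ge0.
- by move=> _; rewrite lee_fin ltW.
by rewrite leeD2l// {3}(splitr e) EFinD pnorm2_leD// lee_fin ltW.
Qed.

Lemma wasserstein_rel_incl x y :
  wasserstein p d A (rel_incl A x) (rel_incl A y) <= d x y.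
Proof.
rewrite -[leRHS](pnorm1 p1)// -[leRHS]/(cost [:: (x, y)]).
by apply: wasserstein_le; split; rewrite big_seq1.
Qed.

End couplings.

(** * The universal property *)

Section extension.
Context (X : choiceType) (A : set X) (N : nmodType) (phi : X -> N).

Definition rel_lift (u : rel_free A) : N :=
  (\sum_(x <- enum_mset (repr u : free_monoid X)) phi x)%R.

Context (phiA : forall x, A x -> phi x = 0%R).

(** Two representatives of a class differ by points of [A], on which [phi]
vanishes, so the chosen representative in [rel_lift] may be replaced by any
other. *)
Lemma rel_lift_sum (s : seq X) :
  rel_lift (\sum_(x <- s) rel_incl A x)%R = (\sum_(x <- s) phi x)%R.
Proof.
have [a [b [aA bA ab]]] := eq_sum_rel_incl
  (esym (rel_free_sum (\sum_(x <- s) rel_incl A x)%R)).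
have sumA (c : seq X) : (forall x, x \in c -> A x) -> (\sum_(x <- c) phi x = 0)%R.
  by move=> cA; rewrite big1_seq// => x /andP[_ /cA /phiA].
have := perm_big _ ab (F := phi) (P := xpredT) (op := +%R) (x := 0%R).
by rewrite !big_cat /= (sumA a aA) (sumA b bA) !addr0.
Qed.

Lemma rel_lift_morphism : GRing.nmod_morphism rel_lift.
Proof.
split=> [|u v]; first by have := rel_lift_sum [::]; rewrite !big_nil.
by rewrite {1}(rel_free_sum u) {1}(rel_free_sum v) -big_cat rel_lift_sum big_cat.
Qed.

Lemma rel_lift_incl : rel_lift \o rel_incl A = phi.
Proof.
by apply/funext => x; have := rel_lift_sum [:: x]; rewrite !big_seq1.
Qed.

Lemma rel_lift_unique (psi : rel_free A -> N) :
  GRing.nmod_morphism psi -> psi \o rel_incl A = phi -> rel_lift = psi.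
Proof.
move=> [psi0 psiD] psi_phi; apply/funext => u.
rewrite [in RHS](rel_free_sum u) /rel_lift -psi_phi.
by rewrite (big_morph psi psiD psi0).
Qed.

End extension.

Lemma subadditive_sum (R : realType) (p : \bar R) (N : nmodType)
    (rho : N -> N -> \bar R) (T : Type) (f g : T -> N) (w : seq T) :
  1 <= p -> subadditive_monoid p rho ->
  rho (\sum_(z <- w) f z)%R (\sum_(z <- w) g z)%R <=
  pnorm p [seq rho (f z) (g z) | z <- w].
Proof.
move=> p1 [[[rho_ge0 rho_refl _ _] _] rhoD].
elim: w => [|z w ih]; first by rewrite !big_nil rho_refl pnorm_ge0.
rewrite !big_cons (le_trans (rhoD _ _ _ _))//= -[_ :: map _ _]cat1s.
by rewrite pnorm_cat// pnorm1// le_pnorm2.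
Qed.

Theorem theorem1p3 (R : realType) (p : \bar R) (X : choiceType)
    (d : X -> X -> \bar R) (A : set X) (hp : 1 <= p) (hXA : metric_pair d A) :
  [/\ subadditive_monoid p (wasserstein p d A),
      pair_map d A (wasserstein p d A) [set 0%R] (rel_incl A) &
      forall (N : nmodType) (rho : N -> N -> \bar R) (phi : X -> N),
        subadditive_monoid p rho ->
        pair_map d A rho [set 0%R] phi ->
        exists! psi : rel_free A -> N,
          [/\ GRing.nmod_morphism psi,
              metric_map (wasserstein p d A) rho psi &
              psi \o rel_incl A = phi]].
Proof.
split.
- split; last by move=> *; exact: wasserstein_subadditive.
  split; last by exists 0%R.
  split.
  + exact: wasserstein_ge0.
  + exact: wasserstein_refl.
  + exact: wasserstein_sym.
  + exact: wasserstein_triangle.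
- split; first exact: wasserstein_rel_incl.
  by move=> _ [x Ax <-]; exact: rel_inclA.
move=> N rho phi rhoP [phi_lip phiA].
have phi0 x : A x -> phi x = 0%R by move=> Ax; apply: phiA; exists x.
exists (rel_lift phi); split; last first.
  by move=> psi [psiM _ psi_phi]; exact: rel_lift_unique.
split; [exact: rel_lift_morphism | | exact: rel_lift_incl].
move=> u v; rewrite (wasserstein_coupling hp hXA).
apply: le_ereal_inf_tmp => _ [w [<- <-] <-].
have liftE (f : X * X -> X) : rel_lift phi (\sum_(z <- w) rel_incl A (f z))%R =
    (\sum_(z <- w) phi (f z))%R.
  by have := rel_lift_sum phi0 (map f w); rewrite !big_map.
rewrite !liftE (le_trans (subadditive_sum _ _ _ hp rhoP))//.
have [[[rho_ge0 _ _ _] _] _] := rhoP.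
by apply: (le_pnorm hp) => z.
Qed.
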